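(* Let $G=(V,E)$ be a graph with $V=\{1,\dots,n\}$, let $\Sigma\subseteq\mathrm{Aut}(G)$ act transitively on the arcs of $G$, and let $v\colon V\to\mathbb{R}^d$ be a $\Sigma$-realization of $G$ of full local dimension. Then (i) $v$ is irreducible, (ii) $v$ is rigid (in $\mathcal{R}_d(G,\Sigma)$), and (iii) $v$ is balanced.
   Context: $G$ is a finite simple undirected graph; $N(i)$ is the neighbourhood of $i$. An arc is an ordered pair $(i,j)$ with $ij\in E$. A realization $v\colon V\to\mathbb{R}^d$ is of full local dimension if for every $i\in V$ the vectors $\{v_j-v_i: j\in N(i)\}$ span $\mathbb{R}^d$ (this implies the $v_i$ span $\mathbb{R}^d$). It is a $\Sigma$-realization if there is a group homomorphism $T\colon\Sigma\to\mathrm{O}(\mathbb{R}^d)$ with $T_\sigma v_i=v_{\sigma(i)}$ for all $i,\sigma$; irreducible if $T$ has no invariant subspaces other than $\{0\}$ and $\mathbb{R}^d$; balanced if there is $\theta\in\mathbb{R}$ with $\sum_{j\in N(i)}v_j=\theta v_i$ for all $i$. The arrangement space of $v$ is the column span of the matrix $M\in\mathbb{R}^{n\times d}$ with rows $v_i^\top$. $\mathcal{R}_d(G,\Sigma)$ is the set of $d$-dimensional $\Sigma$-realizations whose points span $\mathbb{R}^d$, as a subset of $\mathbb{R}^{n\times d}$ with the subspace topology; two realizations are equivalent if they have the same arrangement space; $v$ is rigid if there is no continuous curve $\gamma\colon[0,1]\to\mathcal{R}_d(G,\Sigma)$ with $\gamma(0)=v$ and $\gamma(1)$ not equivalent to $v$.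 *)

(* Defs.v *)
From mathcomp Require Import all_boot all_order all_algebra all_fingroup.
From mathcomp Require Import mxrepresentation.
From mathcomp Require Import all_classical all_reals all_analysis.

Set Implicit Arguments.
Unset Strict Implicit.
Unset Printing Implicit Defensive.

Import numFieldNormedType.Exports.

Local Open Scope ring_scope.
Local Open Scope classical_set_scope.

Record graph (n : nat) := Graph {
  adj : rel 'I_n;
  adj_sym : symmetric adj;
  adj_irr : irreflexive adj }.

Definition nbhd (n : nat) (G : graph n) (i : 'I_n) : {set 'I_n} :=
  [set j | adj G i j]%SET.

Definition graph_aut (n : nat) (G : graph n) : {set 'S_n} :=
  [set s : 'S_n | [forall i, forall j, adj G (s i) (s j) == adj G i j]]%SET.

Definition arc_transitive (n : nat) (G : graph n) (Sigma : {group 'S_n}) :=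
  forall i j k l : 'I_n, adj G i j -> adj G k l ->
    exists s : 'S_n, [/\ s \in Sigma, s i = k & s j = l].

(* A realization v : V -> R^d is the matrix 'M[R]_(n, d) whose i-th row is
   v_i, so that R^d consists of row vectors and linear maps act on the right.
   Since (s * t) i = t (s i) in 'S_n, an mx_representation acting on the right
   is exactly a homomorphism for the composition of permutations acting on the
   left. *)
Definition realizes (R : realType) (n d : nat) (Sigma : {group 'S_n})
    (T : mx_representation R Sigma d) (v : 'M[R]_(n, d)) :=
  (forall s, s \in Sigma -> T s *m (T s)^T = 1%:M) /\
  (forall s i, s \in Sigma -> row i v *m T s = row (s i) v).

Definition sigma_realization (R : realType) (n d : nat)
    (Sigma : {group 'S_n}) (v : 'M[R]_(n, d)) :=
  exists T : mx_representation R Sigma d, realizes T v.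

Definition full_local_dimension (R : realType) (n d : nat) (G : graph n)
    (v : 'M[R]_(n, d)) :=
  forall i : 'I_n, row_full (\sum_(j in nbhd G i) <<row j v - row i v>>)%MS.

(* Unlike mx_irreducible, this does not exclude d = 0. *)
Definition irreducible_rep (R : realType) (n d : nat) (Sigma : {group 'S_n})
    (T : mx_representation R Sigma d) :=
  forall W : 'M[R]_d, mxmodule T W -> (W :=: (0 : 'M[R]_d))%MS \/
                                      (W :=: (1%:M : 'M[R]_d))%MS.

(* T is determined by v as soon as the points of v span R^d. *)
Definition irreducible_realization (R : realType) (n d : nat)
    (Sigma : {group 'S_n}) (v : 'M[R]_(n, d)) :=
  sigma_realization Sigma v /\
  forall T : mx_representation R Sigma d, realizes T v -> irreducible_rep T.

Definition balanced (R : realType) (n d : nat) (G : graph n)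
    (v : 'M[R]_(n, d)) :=
  exists theta : R, forall i : 'I_n,
    \sum_(j in nbhd G i) row j v = theta *: row i v.

Definition realization_space (R : realType) (n d : nat)
    (Sigma : {group 'S_n}) : set 'M[R]_(n, d) :=
  [set v | sigma_realization Sigma v /\ row_full v].

(* Row spaces of the transposes are the column spans. *)
Definition same_arrangement_space (R : realType) (n d : nat)
    (v w : 'M[R]_(n, d)) := (v^T :=: w^T)%MS.

Definition rigid (R : realType) (n d : nat) (Sigma : {group 'S_n})
    (v : 'M[R]_(n, d)) :=
  ~ exists gamma : R -> 'M[R]_(n, d),
      [/\ {within `[0, 1], continuous gamma},
          forall t : R, 0 <= t <= 1 -> realization_space Sigma (gamma t),
          gamma 0 = v &
          ~ same_arrangement_space (gamma 1) v].

(* Main.v *)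
Require Import Defs.
From mathcomp Require Import all_boot all_order all_algebra all_fingroup pgroup.
From mathcomp Require Import mxrepresentation.
From mathcomp Require Import all_classical all_reals all_analysis.

Set Implicit Arguments.
Unset Strict Implicit.
Unset Printing Implicit Defensive.

Import Order.TTheory GRing.Theory Num.Theory.
Import numFieldNormedType.Exports.

Local Open Scope ring_scope.

(** All three claims follow from one fact: every matrix [w] whose rows are
    permuted by [T] in the same way as those of [v] is a scalar multiple of [v].
    Indeed a vector [u] fixed by the stabiliser of [i] has the same inner product
    with all [v_j - v_i], [j] in [N(i)], because the stabiliser is transitive on
    [N(i)]; since these differences span, the fixed vectors form a space of
    dimension at most one, which contains [v_i].

    Applied to the projections of [v] onto an invariant subspace along an
    invariant complement this gives irreducibility, and applied to the sums of
    neighbours it gives balancedness.  For rigidity, if [w] is any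
    Sigma-realization then [v^T w] intertwines the two representations; when it is
    invertible, [w] is [v] times an invertible matrix.  Hence the quotient
    [det(v^T w)^2 / (det(v^T v) det(w^T w))] is [1] or [0] according to whether
    [w] and [v] have the same arrangement space, and by the intermediate value
    theorem it is constant along a curve. *)

(** * Gram matrices of spanning configurations *)

Section Gram.
Context {R : realType} {n d : nat}.

Lemma mulmx_tr_eq0 (u : 'rV[R]_n) : u *m u^T = 0 -> u = 0.
Proof.
move=> /matrixP /(_ 0 0); rewrite !mxE => /eqP.
rewrite psumr_eq0 => [/allP u0|i _]; last by rewrite mxE -expr2 sqr_ge0.
apply/rowP => i; rewrite mxE; apply/eqP.
by have := u0 i (mem_index_enum i); rewrite /= mxE mulf_eq0 orbb.
Qed.

(** If [u *m w^T *m w = 0], then [u *m w^T] has squared norm zero, and [w^T] has trivial left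
    kernel. *)
Lemma gram_unitmx (w : 'M[R]_(n, d)) : row_full w -> w^T *m w \in unitmx.
Proof.
move=> wfull; rewrite -row_free_unit; apply: inj_row_free => u uww.
have wTfree : row_free w^T by rewrite /row_free mxrank_tr.
suff /eqP : u *m w^T = 0 by rewrite mulmx_free_eq0 // => /eqP.
by apply: mulmx_tr_eq0; rewrite trmx_mul trmxK mulmxA -(mulmxA u) uww mul0mx.
Qed.

End Gram.

(** * Entrywise limits of matrix products and determinants *)

Section Continuity.
Local Open Scope classical_set_scope.
Context {R : realType} {T : Type} {F : set_system T} {FF : Filter F}.

Lemma cvg_sum (I : Type) (r : seq I) (P : pred I) (f : I -> T -> R)
    (l : I -> R) :
  (forall i, P i -> f i @ F --> l i) ->
  (fun x => \sum_(i <- r | P i) f i x) @ F --> \sum_(i <- r | P i) l i.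
Proof.
move=> fl; rewrite (_ : (fun x => _) = \sum_(i <- r | P i) f i); last first.
  by apply/funext => x; rewrite fct_sumE.
elim/big_ind2: _ => //; first exact: cvg_cst.
by move=> g1 l1 g2 l2; exact: cvgD.
Qed.

Lemma cvg_prod (I : Type) (r : seq I) (P : pred I) (f : I -> T -> R)
    (l : I -> R) :
  (forall i, P i -> f i @ F --> l i) ->
  (fun x => \prod_(i <- r | P i) f i x) @ F --> \prod_(i <- r | P i) l i.
Proof.
move=> fl; elim: r => [|i r IH].
  by rewrite big_nil; under eq_fun do rewrite big_nil; exact: cvg_cst.
rewrite big_cons; under eq_fun do rewrite big_cons.
by case: ifP => // Pi; apply: cvgM => //; exact: fl.
Qed.

Lemma cvg_det (d : nat) (f : T -> 'M[R]_d) (A : 'M[R]_d) :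
  (forall i j, (fun x => f x i j) @ F --> A i j) ->
  (fun x => \det (f x)) @ F --> \det A.
Proof.
move=> fA; apply: cvg_sum => s _; apply: cvgM; first exact: cvg_cst.
by apply: cvg_prod => i _; exact: fA.
Qed.

Lemma cvg_mulmx (m n p : nat) (f : T -> 'M[R]_(m, n)) (g : T -> 'M[R]_(n, p))
    (A : 'M[R]_(m, n)) (B : 'M[R]_(n, p)) :
  (forall i j, (fun x => f x i j) @ F --> A i j) ->
  (forall i j, (fun x => g x i j) @ F --> B i j) ->
  forall i j, (fun x => (f x *m g x) i j) @ F --> (A *m B) i j.
Proof.
move=> fA gB i j; rewrite mxE; under eq_fun do rewrite mxE.
by apply: cvg_sum => k _; apply: cvgM.
Qed.

End Continuity.

(** * Equivariant configurations and spanning differences *)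

Definition equivariant (R : realType) (n d : nat) (Sigma : {group 'S_n})
    (T : mx_representation R Sigma d) (w : 'M[R]_(n, d)) :=
  forall s i, s \in Sigma -> row i w *m T s = row (s i) w.

Section Realization.
Context {R : realType} {n d : nat} {Sigma : {group 'S_n}}.
Implicit Types (T : mx_representation R Sigma d) (v w : 'M[R]_(n, d)).

(** Both [v *m T1 s] and [w *m T2 s] permute rows by [s], and a permutation matrix cancels against
    its transpose. *)
Lemma equivariant_intertwiner T1 T2 v w : realizes T1 v -> equivariant T2 w ->
  forall s, s \in Sigma -> T1 s *m (v^T *m w) = v^T *m w *m T2 s.
Proof.
move=> [T1o T1v] T2w s sS.
have wE : w *m T2 s = row_perm s w.
  by apply/row_matrixP => i; rewrite row_mul T2w //; apply/rowP => j; rewrite !mxE.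
have vE : v *m T1 s = row_perm s v.
  by apply/row_matrixP => i; rewrite row_mul T1v //; apply/rowP => j; rewrite !mxE.
have T1o' : T1 s *m (T1 s)^T = 1%:M by exact: T1o.
rewrite -[RHS]mul1mx -T1o' -!mulmxA wE; congr (_ *m _).
rewrite !mulmxA -trmx_mul vE !row_permE trmx_mul tr_perm_mx.
by rewrite mulmxA -(mulmxA v^T) -perm_mxM mulVg perm_mx1 mulmx1.
Qed.

Lemma row_full_local (G : graph n) v :
  (0 < n)%N -> full_local_dimension G v -> row_full v.
Proof.
move=> n_gt0 vfull; have := vfull (Ordinal n_gt0).
rewrite -!sub1mx => /submx_trans; apply; apply/sumsmx_subP => j _.
by rewrite genmxE addmx_sub ?eqmx_opp // row_sub.
Qed.

Lemma ortho_full_local (G : graph n) v i (u : 'rV[R]_d) :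
    full_local_dimension G v ->
    (forall j, adj G i j -> u *m (row j v - row i v)^T = 0) ->
  u = 0.
Proof.
move=> /(_ i); rewrite -sub1mx => vfull uv.
suff /(submx_trans vfull) /sub_kermxP :
    (\sum_(j in nbhd G i) <<row j v - row i v>> <= kermx u^T)%MS.
  by rewrite mul1mx => /(congr1 trmx); rewrite trmxK trmx0.
apply/sumsmx_subP => j; rewrite inE genmxE => ij; apply/sub_kermxP.
by apply: trmx_inj; rewrite trmx_mul trmxK uv // trmx0.
Qed.

End Realization.

(** * Consequences of arc-transitivity in positive dimension *)

Section ArcTransitive.
Context {R : realType} {n d : nat} (G : graph n) {Sigma : {group 'S_n}}.
Variables (v : 'M[R]_(n, d)) (T : mx_representation R Sigma d).
Hypotheses (n_gt0 : (0 < n)%N) (d_gt0 : (0 < d)%N).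
Hypothesis Sigma_arc : arc_transitive G Sigma.
Hypotheses (Tv : realizes T v) (v_full : full_local_dimension G v).

Lemma neighbour_exists i : exists j, adj G i j.
Proof.
case: (pickP (adj G i)) => [j ij|noadj]; first by exists j.
have := v_full i; rewrite /row_full big1 => [|j]; last first.
  by rewrite inE noadj.
by rewrite mxrank0 eq_sym -leqn0 leqNgt d_gt0.
Qed.

Lemma vertex_transitive i k : exists2 s, s \in Sigma & s i = k.
Proof.
have [j ij] := neighbour_exists i; have [l kl] := neighbour_exists k.
by have [s [sS si _]] := Sigma_arc ij kl; exists s.
Qed.

Lemma realization_neq0 i : row i v != 0.
Proof.
apply/negP => /eqP vi0; have := row_full_local n_gt0 v_full.
have -> : v = 0.
  apply/row_matrixP => k; have [s sS <-] := vertex_transitive i k.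
  by rewrite -Tv.2 // vi0 mul0mx row0.
by rewrite /row_full mxrank0 eq_sym -leqn0 leqNgt d_gt0.
Qed.

Lemma stab_fixed_scalar i (u : 'rV[R]_d) :
    (forall s, s \in Sigma -> s i = i -> u *m T s = u) ->
  exists a, u = a *: row i v.
Proof.
move=> ufix; have [j0 ij0] := neighbour_exists i.
pose c (x : 'rV[R]_d) := (x *m (row j0 v - row i v)^T) 0 0.
have cE x j : (forall s, s \in Sigma -> s i = i -> x *m T s = x) ->
    adj G i j -> x *m (row j v - row i v)^T = (c x)%:M.
  move=> xfix ij; have [s [sS si sj]] := Sigma_arc ij0 ij.
  have -> : row j v - row i v = (row j0 v - row i v) *m T s.
    by rewrite mulmxBl !Tv.2 // si sj.
  rewrite trmx_mul mulmxA -{1}(xfix s sS si) -(mulmxA x) Tv.1 // mulmx1.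
  exact: mx11_scalar.
have vfix s : s \in Sigma -> s i = i -> row i v *m T s = row i v.
  by move=> sS si; rewrite Tv.2 // si.
have cv0 : c (row i v) != 0.
  apply/negP => /eqP c0; have /negP := realization_neq0 i; apply; apply/eqP.
  by apply: (ortho_full_local (i := i) v_full) => j ij; rewrite cE // c0 raddf0.
(* With this coefficient, [u - a *: row i v] is orthogonal to every difference at [i]. *)
exists (c u / c (row i v)); apply/eqP; rewrite -subr_eq0; apply/eqP.
apply: (ortho_full_local (i := i) v_full) => j ij.
rewrite mulmxBl -scalemxAl (cE u) // (cE (row i v)) // scale_scalar_mx divfK //.
by rewrite subrr.
Qed.

Lemma equivariant_scalar w : equivariant T w -> exists a, w = a *: v.
Proof.
move=> Tw; pose i := Ordinal n_gt0.
have [|a wi] := @stab_fixed_scalar i (row i w).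
  by move=> s sS si; rewrite Tw // si.
exists a; apply/row_matrixP => k; have [s sS <-] := vertex_transitive i k.
by rewrite -Tw // wi -scalemxAl Tv.2 // linearZ.
Qed.

Lemma arc_transitive_irreducible : irreducible_rep T.
Proof.
move=> W modW; have charS : ([pchar R]^'.-group Sigma)%g.
  by apply/pgroupP => p _ _; rewrite inE /= pchar_num.
have [W' modW' sumW dxW] := mx_Maschke_pchar T charS modW (submx1 W).
have capW : (W :&: W')%MS = 0 by exact/mxdirect_addsP.
pose P := proj_mx W W'.
have PT s : s \in Sigma -> T s *m P = P *m T s.
  have /hom_mxP homP : (1%:M <= dom_hom_mx T P)%MS.
    by rewrite -sumW; exact: proj_mx_hom.
  by move=> sS; have := homP s sS; rewrite !mul1mx.
have [|a vP] := @equivariant_scalar (v *m P).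
  by move=> s i sS; rewrite !row_mul -mulmxA -PT // mulmxA Tv.2.
have PE : P = a%:M.
  apply: (row_full_inj (row_full_local n_gt0 v_full)).
  by rewrite vP mul_mx_scalar.
(* The projection [P] fixes [W] and maps into [W], so as a scalar it forces [W] to be zero or
   everything. *)
have [a0|a0] := eqVneq a 0; [left | right].
  have WP : W *m P = W by exact: proj_mx_id.
  by rewrite -WP PE a0 raddf0 mulmx0.
apply/eqmxP; rewrite submx1 /=.
have : (a%:M <= W)%MS by rewrite -PE -[P]mul1mx proj_mx_sub.
by rewrite -scalemx1 eqmx_scale.
Qed.

Lemma arc_transitive_balanced : Sigma \subset graph_aut G -> balanced G v.
Proof.
move=> Saut; pose w := \matrix_i \sum_(j in nbhd G i) row j v.
have [|a wE] := @equivariant_scalar w; last first.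
  by exists a => i; have := congr1 (row i) wE; rewrite rowK linearZ.
(* The automorphism [s] carries the neighbours of [i] onto those of [s i]. *)
move=> s i sS; rewrite /w !rowK mulmx_suml [RHS](reindex_inj (@perm_inj _ s)) /=.
have := fintype.subsetP Saut s sS; rewrite inE => /forallP sA.
apply: eq_big => [j|j _]; last by rewrite Tv.2.
by have /forallP /(_ j) /eqP := sA i; rewrite !inE.
Qed.

Lemma realization_dichotomy w : sigma_realization Sigma w -> row_full w ->
  \det (v^T *m w) = 0 \/ exists2 B, B \in unitmx & w = v *m B.
Proof.
move=> [T' T'w] wfull; set A := v^T *m w.
have [->|A0] := eqVneq (\det A) 0; [by left | right].
have Aunit : A \in unitmx by rewrite unitmxE unitfE.
(* Since [A] intertwines [T] with [T'], multiplying by its inverse turns the [T']-equivariant [w]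
   into a [T]-equivariant configuration. *)
have [|a wA] := @equivariant_scalar (w *m invmx A).
  move=> s i sS; rewrite !row_mul -T'w.2 // -!mulmxA; congr (_ *m _).
  have TA := equivariant_intertwiner Tv T'w.2 sS.
  by rewrite -[LHS](mulmxK Aunit) -(mulmxA (invmx A)) TA mulKmx.
have wE : w = v *m (a *: A) by rewrite -scalemxAr scalemxAl -wA mulmxKV.
(* The row space of [w] is everything and lies in that of [a *: A]. *)
exists (a *: A) => //; rewrite -row_full_unit -sub1mx.
have := wfull; rewrite -sub1mx wE => /submx_trans; apply.
exact: submxMl.
Qed.

Lemma arc_transitive_rigid : rigid Sigma v.
Proof.
move=> [g [gcont greal g0 g1]].
have vfull : row_full v by exact: (row_full_local n_gt0 v_full).
have gram0 (w : 'M[R]_(n, d)) : row_full w -> \det (w^T *m w) != 0.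
  by move=> wfull; have := gram_unitmx wfull; rewrite unitmxE unitfE.
(* The square makes [h] insensitive to the basis: if [g t = v *m B], the factors [\det B] cancel. *)
pose h t := \det (v^T *m g t) * \det (v^T *m g t) /
  (\det (v^T *m v) * \det ((g t)^T *m g t)).
have I01 t : t \in `[0, 1] -> realization_space Sigma (g t).
  by rewrite in_itv /=; exact: greal.
have h01 t : t \in `[0, 1] ->
    h t = 0 \/ h t = 1 /\ exists2 B, B \in unitmx & g t = v *m B.
  move=> /I01 [gt_real gt_full].
  have [d0|[B Bu gE]] := realization_dichotomy gt_real gt_full.
    by left; rewrite /h d0 !mul0r.
  right; split; last by exists B.
  have dB : \det B != 0 by rewrite -unitfE -unitmxE.
  have dV := gram0 _ vfull.
  have vgE : v^T *m g t = v^T *m v *m B by rewrite gE mulmxA.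
  have ggE : (g t)^T *m g t = B^T *m (v^T *m v *m B).
    by rewrite gE trmx_mul !mulmxA.
  rewrite /h vgE ggE !det_mulmx det_tr.
  by rewrite -(mulrA (\det (v^T *m v))) divff // !mulf_neq0.
have hcont : {within `[0, 1]%classic, continuous h}%classic.
  apply/subspace_continuousP => t /= tI.
  have gc i j :
      (g x i j @[x --> within `[0, 1] (nbhs t)] --> g t i j)%classic.
    apply: (@cvg_comp _ _ _ g (fun M : 'M[R]_(n, d) => M i j) _ (nbhs (g t))).
      by move/subspace_continuousP: gcont; apply.
    exact: coord_continuous.
  have [_ /gram0 gt0] := I01 t tI.
  have vg : (\det (v^T *m g x) @[x --> within `[0, 1] (nbhs t)] -->
      \det (v^T *m g t))%classic.
    by apply: cvg_det; apply: cvg_mulmx => // i j; exact: cvg_cst.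
  apply: cvgM; first exact: cvgM.
  apply: cvgV; first by rewrite mulf_neq0 // gram0.
  apply: cvgM; first exact: cvg_cst.
  apply: cvg_det; apply: cvg_mulmx => // i j.
  rewrite mxE; under eq_fun do rewrite mxE.
  exact: gc.
have zI : (0 : R) \in `[0, 1] by rewrite in_itv /= lexx ler01.
have oI : (1 : R) \in `[0, 1] by rewrite in_itv /= lexx ler01.
have h0 : h 0 = 1.
  by rewrite /h g0 divff ?mulf_neq0 ?gram0.
have [h1|[_ [B Bu gE]]] := h01 1 oI; last first.
  apply: g1; rewrite /same_arrangement_space gE trmx_mul.
  by apply: eqmxMfull; rewrite row_full_unit unitmx_tr.
(* Any value strictly between 0 and 1 would contradict [h01]. *)
have [|c cI hc] := @IVT R h 0 1 2^-1 ler01 hcont.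
  by rewrite h0 h1 minEle maxEle ler10 /= invr_ge0 ler0n invf_le1 ?ler1n.
have := h01 c cI; rewrite hc => -[|[]] /eqP; rewrite ?invr_eq0 ?pnatr_eq0 //.
by rewrite invr_eq1 (eqr_nat _ 2 1).
Qed.

End ArcTransitive.

Theorem theorem4p10 (R : realType) (n d : nat) (n_gt0 : (0 < n)%N)
    (G : graph n) (Sigma : {group 'S_n}) (v : 'M[R]_(n, d))
    (Sigma_aut : Sigma \subset graph_aut G)
    (Sigma_arc : arc_transitive G Sigma)
    (v_real : sigma_realization Sigma v)
    (v_full : full_local_dimension G v) :
  [/\ irreducible_realization Sigma v, rigid Sigma v & balanced G v].
Proof.
(* For [d = 0] full local dimension does not provide neighbours, but all matrices with no columns
   coincide. *)
have [d0|d_gt0] := posnP d.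
  subst d; split.
  - by split=> // T _ W _; left; rewrite [W]thinmx0.
  - move=> [g [_ _ _]]; apply.
    by rewrite /same_arrangement_space [g 1]thinmx0 [v]thinmx0.
  - by exists 0 => i; rewrite [LHS]thinmx0 [RHS]thinmx0.
have [T Tv] := v_real; split.
- split=> // T' T'v.
  exact: arc_transitive_irreducible n_gt0 d_gt0 Sigma_arc T'v v_full.
- exact: arc_transitive_rigid n_gt0 d_gt0 Sigma_arc Tv v_full.
- exact: arc_transitive_balanced n_gt0 d_gt0 Sigma_arc Tv v_full Sigma_aut.
Qed.
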